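(* Consider the recurrence relations $$f_ka_{k-1}+g_ka_k+h_ka_{k+1}=0 \qquad ( * )$$ on a sequence $(a_k)_{k\in\mathbb Z_{\ge0}}$ of complex numbers, where the sequences $g_k,f_k,h_k\in\mathbb C$ satisfy the following conditions: $f_k\neq0$ and $h_k\ne0$ for every $k$, and $$f_k=o(g_k),\quad h_k=o(g_k),\quad\text{as } k\to\infty .$$ Then there exists a unique (up to a constant factor) series $\sum_{k=0}^{+\infty}a_kz^k\not\equiv0$ whose coefficients $a_k$ satisfy $( * )$ for all $k\geq1$ and which has non-zero convergence radius. Moreover, this series converges on all of $\mathbb C$. *)

(* Defs.v *)
From Stdlib Require Import Reals.
From Coquelicot Require Import Coquelicot.
Open Scope R_scope.

(* [is_domin F g f] puts the dominating function first, so [little_o f g]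
   is [f = o(g)]: for all eps > 0, eventually |f k| <= eps |g k|. *)
Definition little_o (f g : nat -> C) : Prop :=
  is_domin (U := C_NormedModule) (V := C_NormedModule) eventually g f.

Definition complex_pseries_converges (a : nat -> C) (z : C) : Prop :=
  ex_pseries (K := C_AbsRing) (V := C_NormedModule) a z.

(* [CV_radius] is only available for real coefficients; the supremum below
   is over a set containing 0, so it lies in [0, +oo]. *)
Definition complex_CV_radius (a : nat -> C) : Rbar :=
  Lub_Rbar (fun r : R =>
    exists z : C, Cmod z = r /\ complex_pseries_converges a z).

Definition satisfies_recurrence (f g h a : nat -> C) : Prop :=
  forall k : nat, (1 <= k)%nat ->
    (f k * a (k - 1)%nat + g k * a k + h k * a (k + 1)%nat)%C = RtoC 0.

Definition convergent_series_solution (f g h a : nat -> C) : Prop :=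
  (exists k : nat, a k <> RtoC 0) /\
  satisfies_recurrence f g h a /\
  complex_CV_radius a <> Finite 0.

(* Main.v *)
(** Dividing the recurrence by [g k] shows that the moduli [x k] of a solution
    satisfy [K x (k+1) <= x k + x (k+2)] for large [k], whatever [K] is.  Hence,
    once [x] increases, it grows geometrically with a rate as large as desired,
    so a solution with positive radius of convergence is eventually nonincreasing;
    then [K x (k+1) <= x k + x (k+1)] and the ratios [x (k+1) / x k] tend to 0,
    so the series is entire.  Given two such solutions, a nontrivial linear
    combination vanishes at a large index; it is nonincreasing from there, hence
    zero from there, and zero everywhere because [f k <> 0].  A bounded solution
    exists: far enough, prescribing the initial term, the recurrence written as
    [a k = - f k / g k a (k-1) - h k / g k a (k+1)] is a fixed point equation for
    a contraction of the bounded sequences; one then descends to index 0, again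
    because [f k <> 0]. *)

Require Import Defs.
From Stdlib Require Import Reals Lra Lia ClassicalEpsilon.
From Coquelicot Require Import Coquelicot.
Open Scope R_scope.

(** * Growth dichotomy for nonnegative real sequences *)

Lemma geometric_bound_contradiction (K R M c : R) :
  0 < R -> R < K -> 0 < c -> (forall j : nat, K ^ j * c <= M * R ^ j) -> False.
Proof.
  intros HR HK Hc H.
  assert (H1 : 1 < K / R).
  { apply Rmult_lt_reg_r with R; [lra|].
    unfold Rdiv; rewrite Rmult_assoc, Rinv_l; lra. }
  destruct (Pow_x_infinity (K / R)) with (b := M / c + 1) as [n Hn].
  { rewrite Rabs_pos_eq; lra. }
  specialize (Hn n (le_n n)).
  rewrite Rabs_pos_eq in Hn by (apply pow_le; lra).
  assert (HRn : 0 < R ^ n) by (apply pow_lt; lra).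
  assert (H2 : (K / R) ^ n * c <= M).
  { apply Rmult_le_reg_r with (R ^ n); [lra|].
    replace ((K / R) ^ n * c * R ^ n) with (K ^ n * c); [apply H|].
    unfold Rdiv; rewrite Rpow_mult_distr, pow_inv; field; lra. }
  assert (H3 : (M / c + 1) * c <= (K / R) ^ n * c)
    by (apply Rmult_le_compat_r; lra).
  replace ((M / c + 1) * c) with (M + c) in H3 by (field; lra).
  lra.
Qed.

(** After an increase, one of the [K + 1] copies of [x (S n)] absorbs [x n], leaving
    [K * x (S n) <= x (S (S n))]. As [1 <= K], this is again an increase, so the induction carries
    monotonicity along with growth. *)
Lemma growth_after_increase (x : nat -> R) (K : R) (N n : nat) :
  1 <= K -> (forall k, 0 <= x k) ->
  (forall k, (N <= k)%nat -> (K + 1) * x (S k) <= x k + x (S (S k))) ->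
  (N <= n)%nat -> x n <= x (S n) ->
  forall j, K ^ j * x (S n) <= x (S n + j)%nat.
Proof.
  intros HK Hpos H Hn Hinc.
  assert (A : forall j, x (n + j)%nat <= x (S (n + j)) /\
                        K ^ j * x (S n) <= x (S (n + j))).
  { induction j as [|j [IH1 IH2]].
    - rewrite Nat.add_0_r; simpl; split; lra.
    - replace (n + S j)%nat with (S (n + j)) by lia.
      assert (H1 := H (n + j)%nat ltac:(lia)).
      assert (H2 : K * x (S (n + j)) <= x (S (S (n + j)))) by lra.
      assert (H3 : K * (K ^ j * x (S n)) <= K * x (S (n + j)))
        by (apply Rmult_le_compat_l; lra).
      assert (H4 : 1 * x (S (n + j)) <= K * x (S (n + j)))
        by (apply Rmult_le_compat_r; auto).
      simpl; split; lra. }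
  intros j; apply A.
Qed.

(** A single strict increase beyond [N] would force growth like [K ^ j], against the bound in
    [R ^ j]. The threshold is that of the inequality, whatever [M] is, so many sequences can share
    it. *)
Lemma eventually_nonincreasing (x : nat -> R) (K R M : R) (N : nat) :
  1 <= K -> 0 < R -> R < K -> (forall k, 0 <= x k) ->
  (forall k, (N <= k)%nat -> (K + 1) * x (S k) <= x k + x (S (S k))) ->
  (forall k, x k <= M * R ^ k) ->
  forall n, (N <= n)%nat -> x (S n) <= x n.
Proof.
  intros HK HR HRK Hpos H HM n Hn.
  destruct (Rle_lt_dec (x (S n)) (x n)) as [|Hlt]; [assumption|exfalso].
  apply geometric_bound_contradiction with K R (M * R ^ S n) (x (S n)); try lra.
  { specialize (Hpos n); lra. }
  intros j.
  rewrite Rmult_assoc, <- pow_add.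
  eapply Rle_trans; [|apply HM].
  apply growth_after_increase with N; auto; lra.
Qed.

Lemma nonincreasing_le (x : nat -> R) (N : nat) :
  (forall n, (N <= n)%nat -> x (S n) <= x n) ->
  forall m n, (N <= m)%nat -> (m <= n)%nat -> x n <= x m.
Proof.
  intros H m n Hm Hmn; induction Hmn as [|n Hmn IH]; [lra|].
  specialize (H n ltac:(lia)); lra.
Qed.

Lemma bounded_of_eventually_nonincreasing (x : nat -> R) (N : nat) :
  (forall n, (N <= n)%nat -> x (S n) <= x n) ->
  exists M, forall k, x k <= M.
Proof.
  intros H.
  assert (A : forall n, exists M, forall k, (k <= n)%nat -> x k <= M).
  { induction n as [|n [M HM]].
    - exists (x 0%nat); intros k Hk; replace k with 0%nat by lia; lra.
    - exists (Rmax M (x (S n))); intros k Hk.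
      destruct (Nat.eq_dec k (S n)) as [->|Hne]; [apply Rmax_r|].
      eapply Rle_trans; [apply HM; lia|apply Rmax_l]. }
  destruct (A N) as [M HM]; exists M; intros k.
  destruct (Nat.le_gt_cases k N) as [Hk|Hk]; [auto|].
  eapply Rle_trans; [|apply (HM N); lia].
  apply nonincreasing_le with N; auto; lia.
Qed.

(** * Complex power series and their radius of convergence *)

Lemma Cmod_pow_n (z : C) (n : nat) :
  Cmod (pow_n (K := C_AbsRing) z n) = Cmod z ^ n.
Proof.
  induction n as [|n IH]; [exact Cmod_1|].
  simpl; rewrite <- IH; apply Cmod_mult.
Qed.

(** Partial sums of a convergent series are bounded, and each term after the first is a difference
    of two consecutive ones; hence the bound [M + M] on the terms. *)
Lemma coeff_bound_of_converges (a : nat -> C) (z : C) :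
  complex_pseries_converges a z -> z <> RtoC 0 ->
  exists M, forall k, Cmod (a k) <= M * (/ Cmod z) ^ k.
Proof.
  intros Ha Hz.
  assert (Hz' : 0 < Cmod z) by (apply Cmod_gt_0; exact Hz).
  destruct (filterlim_bounded _ Ha) as [M HM].
  exists (M + M); intros k.
  assert (Hk : 0 < Cmod z ^ k) by (apply pow_lt; lra).
  apply Rmult_le_reg_l with (Cmod z ^ k); [lra|].
  replace (Cmod z ^ k * ((M + M) * (/ Cmod z) ^ k)) with (M + M)
    by (rewrite pow_inv; field; lra).
  rewrite <- Cmod_pow_n, <- Cmod_mult.
  destruct k as [|k].
  - assert (H0 := HM 0%nat); rewrite sum_O in H0.
    change (Cmod (pow_n (K := C_AbsRing) z 0 * a 0%nat) <= M) in H0.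
    assert (H1 := Cmod_ge_0 (pow_n (K := C_AbsRing) z 0 * a 0%nat)).
    lra.
  - assert (H0 := HM k); assert (H1 := HM (S k)).
    rewrite sum_Sn in H1.
    set (s := sum_n _ k) in *.
    change (Cmod s <= M) in H0.
    change (Cmod (s + pow_n (K := C_AbsRing) z (S k) * a (S k))%C <= M) in H1.
    replace (pow_n (K := C_AbsRing) z (S k) * a (S k))%C
      with ((s + pow_n (K := C_AbsRing) z (S k) * a (S k)) + - s)%C by ring.
    eapply Rle_trans; [apply Cmod_triangle|].
    rewrite Cmod_opp; lra.
Qed.

(** Comparison, from index [N] on, with a geometric series of ratio [Cmod z / K]. The ratio bound is
    stated as a product so that coefficients may vanish. *)
Lemma converges_of_ratio_bound (a : nat -> C) (z : C) (K : R) (N : nat) :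
  Cmod z < K ->
  (forall k, (N <= k)%nat -> K * Cmod (a (S k)) <= Cmod (a k)) ->
  complex_pseries_converges a z.
Proof.
  intros HK H.
  assert (Hz := Cmod_ge_0 z).
  apply (ex_series_incr_n (V := C_NormedModule)) with (n := N).
  apply (ex_series_le (V := C_CompleteNormedModule))
    with (fun j => Cmod z ^ N * Cmod (a N) * (Cmod z / K) ^ j).
  2:{ apply (ex_series_scal (K := R_AbsRing) (V := R_NormedModule)).
      apply ex_series_geom.
      rewrite Rabs_pos_eq.
      - apply Rmult_lt_reg_r with K; [lra|].
        unfold Rdiv; rewrite Rmult_assoc, Rinv_l; lra.
      - apply Rdiv_le_0_compat; lra. }
  intros j.
  change (Cmod (pow_n (K := C_AbsRing) z (N + j) * a (N + j)%nat)
          <= Cmod z ^ N * Cmod (a N) * (Cmod z / K) ^ j).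
  rewrite Cmod_mult, Cmod_pow_n, pow_add.
  assert (A : Cmod (a (N + j)%nat) <= Cmod (a N) * (/ K) ^ j).
  { induction j as [|j IH]; [rewrite Nat.add_0_r; simpl; lra|].
    assert (H1 := H (N + j)%nat ltac:(lia)).
    replace (N + S j)%nat with (S (N + j)) by lia.
    apply Rmult_le_reg_l with K; [lra|].
    simpl; replace (K * (Cmod (a N) * (/ K * (/ K) ^ j)))
      with (Cmod (a N) * (/ K) ^ j) by (field; lra).
    lra. }
  unfold Rdiv; rewrite Rpow_mult_distr.
  replace (Cmod z ^ N * Cmod (a N) * (Cmod z ^ j * (/ K) ^ j))
    with (Cmod z ^ N * Cmod z ^ j * (Cmod (a N) * (/ K) ^ j)) by ring.
  apply Rmult_le_compat_l; [|exact A].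
  apply Rmult_le_pos; apply pow_le; lra.
Qed.

(** Moduli are nonnegative and 0 is attained at [z = 0], so the supremum is 0 exactly when there is
    no other point of convergence. *)
Lemma complex_CV_radius_neq_0 (a : nat -> C) :
  complex_CV_radius a <> Finite 0 <->
  exists z : C, z <> RtoC 0 /\ complex_pseries_converges a z.
Proof.
  unfold complex_CV_radius; set (E := fun r : R => _).
  destruct (Lub_Rbar_correct E) as [Hub Hlub].
  split.
  - intros Hr.
    destruct (excluded_middle_informative
      (exists z : C, z <> RtoC 0 /\ complex_pseries_converges a z)) as [|Hn];
      [assumption|exfalso; apply Hr].
    apply Rbar_le_antisym.
    + apply Hlub; intros r [z [<- Hz]].
      destruct (excluded_middle_informative (z = RtoC 0)) as [->|Hz0].
      * rewrite Cmod_0; apply Rle_refl.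
      * exfalso; eauto.
    + apply Hub; exists (RtoC 0); split; [exact Cmod_0|].
      exact (ex_pseries_0 (V := C_NormedModule) a).
  - intros [z [Hz Ha]] Hr.
    assert (H := Hub (Cmod z) (ex_intro _ z (conj eq_refl Ha))).
    rewrite Hr in H; simpl in H.
    apply Cmod_gt_0 in Hz; lra.
Qed.

(** * Linear structure of the solutions *)

Definition bounded_seq (a : nat -> C) : Prop := exists M, forall k, Cmod (a k) <= M.

Lemma recurrence_S (f g h a : nat -> C) :
  satisfies_recurrence f g h a <->
  forall k, (f (S k) * a k + g (S k) * a (S k) + h (S k) * a (S (S k)))%C = RtoC 0.
Proof.
  split.
  - intros H k; specialize (H (S k) ltac:(lia)).
    replace (S k - 1)%nat with k in H by lia.
    replace (S k + 1)%nat with (S (S k)) in H by lia; exact H.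
  - intros H k Hk; destruct k as [|k]; [lia|].
    replace (S k - 1)%nat with k by lia.
    replace (S k + 1)%nat with (S (S k)) by lia; apply H.
Qed.

Lemma satisfies_recurrence_comb (f g h a b : nat -> C) (c d : C) :
  satisfies_recurrence f g h a -> satisfies_recurrence f g h b ->
  satisfies_recurrence f g h (fun k => (c * a k - d * b k)%C).
Proof.
  intros Ha Hb k Hk; specialize (Ha k Hk); specialize (Hb k Hk).
  transitivity (c * (f k * a (k - 1)%nat + g k * a k + h k * a (k + 1)%nat)
    - d * (f k * b (k - 1)%nat + g k * b k + h k * b (k + 1)%nat))%C; [ring|].
  rewrite Ha, Hb; ring.
Qed.

(** Descent: since [f (S N)] is nonzero, the relation at index [S N] determines [a N] from the next
    two terms. *)
Lemma solution_zero_of_tail (f g h a : nat -> C) (N : nat) :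
  (forall k, f k <> RtoC 0) -> satisfies_recurrence f g h a ->
  (forall k, (N <= k)%nat -> a k = RtoC 0) -> forall k, a k = RtoC 0.
Proof.
  intros Hf Ha; rewrite recurrence_S in Ha.
  induction N as [|N IH]; intros HN; [intros k; apply HN; lia|].
  apply IH; intros k Hk.
  destruct (Nat.eq_dec k N) as [->|Hne]; [|apply HN; lia].
  specialize (Ha N).
  rewrite (HN (S N)), (HN (S (S N))) in Ha by lia.
  destruct (excluded_middle_informative (a N = RtoC 0)) as [|Hn]; [assumption|].
  exfalso; apply (Cmult_neq_0 _ _ (Hf (S N)) Hn).
  rewrite <- Ha; ring.
Qed.

(** * Asymptotics and uniqueness of bounded solutions *)

Lemma little_o_eventually (f g h : nat -> C) (eps : R) :
  little_o f g -> little_o h g -> 0 < eps ->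
  exists N, forall k, (N <= k)%nat ->
    Cmod (f k) <= eps * Cmod (g k) /\ Cmod (h k) <= eps * Cmod (g k).
Proof.
  intros Hf Hh He.
  destruct (Hf (mkposreal eps He)) as [N1 H1].
  destruct (Hh (mkposreal eps He)) as [N2 H2].
  exists (N1 + N2)%nat; intros k Hk; split; [apply H1|apply H2]; lia.
Qed.

(** [N] is chosen before [a]: it depends only on the coefficients and [K]. The uniqueness argument
    relies on this uniformity, since it compares two solutions and a combination of them at one
    index. *)
Lemma solution_modulus_ineq (f g h : nat -> C) (K : R) :
  (forall k, f k <> RtoC 0) -> little_o f g -> little_o h g -> 0 < K ->
  exists N, forall a, satisfies_recurrence f g h a ->
    forall k, (N <= k)%nat ->
      K * Cmod (a (S k)) <= Cmod (a k) + Cmod (a (S (S k))).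
Proof.
  intros Hf Hfg Hhg HK.
  destruct (little_o_eventually f g h (/ K) Hfg Hhg (Rinv_0_lt_compat _ HK))
    as [N HN].
  exists N; intros a Ha k Hk; rewrite recurrence_S in Ha; specialize (Ha k).
  destruct (HN (S k) ltac:(lia)) as [H1 H2].
  assert (Hfk : 0 < Cmod (f (S k))) by (apply Cmod_gt_0; apply Hf).
  assert (HiK : 0 < / K) by (apply Rinv_0_lt_compat; lra).
  (* Domination of the nonzero [f (S k)] excludes a zero of [g] here. *)
  assert (Hg : 0 < Cmod (g (S k))) by nra.
  assert (H3 : Cmod (g (S k)) * Cmod (a (S k)) <=
    Cmod (f (S k)) * Cmod (a k) + Cmod (h (S k)) * Cmod (a (S (S k)))).
  { rewrite <- !Cmod_mult.
    replace (g (S k) * a (S k))%C with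
      (- (f (S k) * a k + h (S k) * a (S (S k))))%C.
    - rewrite Cmod_opp; apply Cmod_triangle.
    - transitivity (g (S k) * a (S k) -
        (f (S k) * a k + g (S k) * a (S k) + h (S k) * a (S (S k))))%C; [ring|].
      rewrite Ha; ring. }
  assert (P1 := Cmod_ge_0 (a k)).
  assert (P2 := Cmod_ge_0 (a (S (S k)))).
  assert (H4 : Cmod (f (S k)) * Cmod (a k) <= / K * Cmod (g (S k)) * Cmod (a k))
    by (apply Rmult_le_compat_r; lra).
  assert (H5 : Cmod (h (S k)) * Cmod (a (S (S k))) <=
               / K * Cmod (g (S k)) * Cmod (a (S (S k))))
    by (apply Rmult_le_compat_r; lra).
  apply Rmult_le_reg_l with (/ K * Cmod (g (S k))).
  { apply Rmult_lt_0_compat; lra. }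
  replace (/ K * Cmod (g (S k)) * (K * Cmod (a (S k))))
    with (Cmod (g (S k)) * Cmod (a (S k))) by (field; lra).
  lra.
Qed.

Lemma bounded_solutions_nonincreasing (f g h : nat -> C) :
  (forall k, f k <> RtoC 0) -> little_o f g -> little_o h g ->
  exists N, forall a, satisfies_recurrence f g h a -> bounded_seq a ->
    forall n, (N <= n)%nat -> Cmod (a (S n)) <= Cmod (a n).
Proof.
  intros Hf Hfg Hhg.
  (* This is [K + 1] with [K = 2], which exceeds the rate [R = 1] of a bounded sequence. *)
  destruct (solution_modulus_ineq f g h (2 + 1) Hf Hfg Hhg) as [N HN]; [lra|].
  exists N; intros a Ha [M HM].
  apply (eventually_nonincreasing (fun k => Cmod (a k)) 2 1 M); try lra.
  - intros k; apply Cmod_ge_0.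
  - apply HN, Ha.
  - intros k; rewrite pow1, Rmult_1_r; apply HM.
Qed.

Lemma convergent_solution_bounded (f g h a : nat -> C) :
  (forall k, f k <> RtoC 0) -> little_o f g -> little_o h g ->
  convergent_series_solution f g h a -> bounded_seq a.
Proof.
  intros Hf Hfg Hhg [_ [Ha Hr]].
  apply complex_CV_radius_neq_0 in Hr; destruct Hr as [z [Hz Hc]].
  destruct (coeff_bound_of_converges a z Hc Hz) as [M HM].
  assert (HR : 0 < / Cmod z) by (apply Rinv_0_lt_compat, Cmod_gt_0, Hz).
  (* Here [K = / Cmod z + 1], which is at least 1 and exceeds the rate [R = / Cmod z] of the
     coefficient bound. *)
  destruct (solution_modulus_ineq f g h (/ Cmod z + 1 + 1) Hf Hfg Hhg)
    as [N HN]; [lra|].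
  apply (bounded_of_eventually_nonincreasing (fun k => Cmod (a k)) N).
  apply (eventually_nonincreasing (fun k => Cmod (a k)) (/ Cmod z + 1) (/ Cmod z) M);
    try lra.
  - intros k; apply Cmod_ge_0.
  - apply HN, Ha.
  - exact HM.
Qed.

Lemma bounded_solution_entire (f g h a : nat -> C) (z : C) :
  (forall k, f k <> RtoC 0) -> little_o f g -> little_o h g ->
  satisfies_recurrence f g h a -> bounded_seq a -> complex_pseries_converges a z.
Proof.
  intros Hf Hfg Hhg Ha Hb.
  assert (Hz := Cmod_ge_0 z).
  destruct (bounded_solutions_nonincreasing f g h Hf Hfg Hhg) as [N1 H1].
  (* Monotonicity costs one unit of the factor, leaving the ratio bound with [Cmod z + 1], still
     above [Cmod z]. *)
  destruct (solution_modulus_ineq f g h (Cmod z + 2) Hf Hfg Hhg) as [N2 H2]; [lra|].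
  apply converges_of_ratio_bound with (Cmod z + 1) (N1 + N2)%nat; [lra|].
  intros k Hk.
  specialize (H1 a Ha Hb (S k) ltac:(lia)).
  specialize (H2 a Ha k ltac:(lia)).
  lra.
Qed.

Lemma bounded_solutions_proportional (f g h a b : nat -> C) :
  (forall k, f k <> RtoC 0) -> little_o f g -> little_o h g ->
  satisfies_recurrence f g h a -> bounded_seq a -> (exists k, a k <> RtoC 0) ->
  satisfies_recurrence f g h b -> bounded_seq b -> (exists k, b k <> RtoC 0) ->
  exists c : C, c <> RtoC 0 /\ forall k, b k = (c * a k)%C.
Proof.
  intros Hf Hfg Hhg Ha HMa Hna Hb HMb Hnb.
  destruct (bounded_solutions_nonincreasing f g h Hf Hfg Hhg) as [N HN].
  (* A bounded solution is determined by its value at [N]. *)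
  assert (Z : forall u, satisfies_recurrence f g h u -> bounded_seq u ->
                        u N = RtoC 0 -> forall k, u k = RtoC 0).
  { intros u Hu HMu Hu0.
    apply solution_zero_of_tail with f g h N; auto.
    intros k Hk; apply Cmod_eq_0, Rle_antisym; [|apply Cmod_ge_0].
    rewrite <- Cmod_0, <- Hu0.
    apply (nonincreasing_le (fun k => Cmod (u k)) N); auto. }
  assert (HaN : a N <> RtoC 0).
  { intros H0; destruct Hna as [k Hk]; apply Hk, Z; auto. }
  assert (HbN : b N <> RtoC 0).
  { intros H0; destruct Hnb as [k Hk]; apply Hk, Z; auto. }
  exists (b N / a N)%C; split.
  { apply Cmult_neq_0; [exact HbN|].
    apply Cmod_gt_0; rewrite Cmod_inv by exact HaN.
    apply Rinv_0_lt_compat, Cmod_gt_0, HaN. }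
  intros k.
  assert (H0 : (a N * b k - b N * a k)%C = RtoC 0).
  { apply (Z (fun k => (a N * b k - b N * a k)%C)).
    - apply satisfies_recurrence_comb; assumption.
    - destruct HMa as [M HM]; destruct HMb as [M' HM'].
      exists (Cmod (a N) * M' + Cmod (b N) * M); intros j.
      eapply Rle_trans; [apply Cmod_triangle|].
      rewrite Cmod_opp, !Cmod_mult.
      apply Rplus_le_compat; apply Rmult_le_compat_l; auto using Cmod_ge_0.
    - ring. }
  transitivity ((a N * b k - b N * a k) / a N + b N / a N * a k)%C;
    [field; exact HaN|].
  rewrite H0; field; exact HaN.
Qed.

(** The increments of the Picard iteration started at [(1, 0, 0, ...)] for the
    contraction fixing the initial term. *)
Fixpoint picard_increment (p q : nat -> C) (n : nat) : nat -> C :=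
  match n with
  | O => fun k => match k with O => RtoC 1 | S _ => RtoC 0 end
  | S n => fun k =>
      match k with
      | O => RtoC 0
      | S j => (- (p k * picard_increment p q n j)
                - q k * picard_increment p q n (S k))%C
      end
  end.

(** Two coefficients of modulus at most [/ 4] halve the sup norm at each iteration. *)
Lemma Cmod_picard_increment (p q : nat -> C) (n k : nat) :
  (forall k, Cmod (p (S k)) <= / 4) -> (forall k, Cmod (q (S k)) <= / 4) ->
  Cmod (picard_increment p q n k) <= (/ 2) ^ n.
Proof.
  intros Hp Hq; revert k; induction n as [|n IH]; intros k.
  - destruct k; simpl; rewrite ?Cmod_1, ?Cmod_0; lra.
  - destruct k as [|k].
    + simpl picard_increment; rewrite Cmod_0; apply pow_le; lra.
    + simpl picard_increment.
      eapply Rle_trans; [apply Cmod_triangle|].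
      rewrite !Cmod_opp, !Cmod_mult.
      assert (H1 := Rmult_le_compat _ _ _ _ (Cmod_ge_0 _) (Cmod_ge_0 _) (Hp k) (IH k)).
      assert (H2 := Rmult_le_compat _ _ _ _ (Cmod_ge_0 _) (Cmod_ge_0 _)
                      (Hq k) (IH (S (S k)))).
      simpl pow; lra.
Qed.

(** The solution is the sum of the increments. Each is the image of the previous one under a linear
    map [T], so summing termwise gives [a = d 0 + T a]. *)
Lemma contraction_fixed_point (p q : nat -> C) :
  (forall k, Cmod (p (S k)) <= / 4) -> (forall k, Cmod (q (S k)) <= / 4) ->
  exists a : nat -> C, a 0%nat = RtoC 1 /\ bounded_seq a /\
    forall k, a (S k) = (- (p (S k) * a k) - q (S k) * a (S (S k)))%C.
Proof.
  intros Hp Hq.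
  set (d := picard_increment p q).
  assert (Hd : forall n k, Cmod (d n k) <= (/ 2) ^ n)
    by (intros; apply Cmod_picard_increment; assumption).
  assert (Hgeo : ex_series (fun n => (/ 2) ^ n))
    by (apply ex_series_geom; rewrite Rabs_pos_eq; lra).
  assert (Hex : forall k, exists l : C,
             is_series (V := C_NormedModule) (fun n => d n k) l).
  { intros k.
    apply (ex_series_le (V := C_CompleteNormedModule)) with (fun n => (/ 2) ^ n);
      [intros n; apply Hd|exact Hgeo]. }
  set (a := fun k => proj1_sig (constructive_indefinite_description _ (Hex k))).
  assert (Ha : forall k, is_series (V := C_NormedModule) (fun n => d n k) (a k))
    by (intros k; exact (proj2_sig (constructive_indefinite_description _ (Hex k)))).
  assert (Huniq : forall (u : nat -> C) (l l' : C),
             is_series (V := C_NormedModule) u l ->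
             is_series (V := C_NormedModule) u l' -> l = l').
  { intros u l l' H H'; exact (filterlim_locally_unique _ l l' H H'). }
  assert (Htail : forall k, is_series (V := C_NormedModule)
             (fun n => d (S n) k) (a k - d 0%nat k)%C).
  { intros k; apply (is_series_incr_1 (V := C_NormedModule) (fun n => d n k)).
    assert (E : a k = (a k - d 0%nat k + d 0%nat k)%C) by ring.
    exact (eq_ind _ (is_series (V := C_NormedModule) _) (Ha k) _ E). }
  exists a; repeat split.
  - apply (Huniq (fun n => d n 0%nat)); [apply Ha|].
    apply (is_series_decr_1 (V := C_NormedModule)).
    (* Every later increment vanishes at index 0; that their sum is 0 comes from scaling a
       convergent series by 0. *)
    assert (H0 := is_series_scal (V := C_NormedModule) (RtoC 0) _ _ (Ha 0%nat)).
    assert (E : (RtoC 0 * a 0%nat)%C = (RtoC 1 + - RtoC 1)%C) by ring.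
    apply (fun H => eq_ind _ (is_series (V := C_NormedModule) _) H _ E).
    eapply is_series_ext; [|exact H0]; intros n.
    change ((RtoC 0 * d n 0%nat)%C = RtoC 0); ring.
  - exists (Series (fun n => (/ 2) ^ n)); intros k.
    assert (Hb := Series_correct _ Hgeo).
    apply (filterlim_le (F := eventually) (fun n => norm (sum_n (fun n => d n k) n))
      (sum_n (fun n => (/ 2) ^ n)) (Finite (Cmod (a k)))
      (Finite (Series (fun n => (/ 2) ^ n)))).
    + apply filter_forall; intros n.
      eapply Rle_trans; [apply (norm_sum_n_m (V := C_NormedModule))|].
      apply sum_n_m_le; intros j; apply Hd.
    + exact (filterlim_comp _ _ _ _ _ _ _ _ (Ha k) (filterlim_norm (a k))).
    + exact Hb.
  - intros k.
    transitivity (a (S k) - RtoC 0)%C; [ring|].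
    (* The first increment vanishes off index 0, so [a (S k)] is the sum of the later increments
       alone. *)
    change (RtoC 0) with (d 0%nat (S k)).
    apply (Huniq (fun n => d (S n) (S k))); [apply Htail|].
    assert (H1 := is_series_scal (V := C_NormedModule) (- p (S k))%C _ _ (Ha k)).
    assert (H2 := is_series_scal (V := C_NormedModule) (- q (S k))%C _ _
                    (Ha (S (S k)))).
    assert (H3 := is_series_plus _ _ _ _ H1 H2).
    assert (E : (- p (S k) * a k + - q (S k) * a (S (S k)))%C
                = (- (p (S k) * a k) - q (S k) * a (S (S k)))%C) by ring.
    apply (fun H => eq_ind _ (is_series (V := C_NormedModule) _) H _ E).
    eapply is_series_ext; [|exact H3]; intros n.
    change ((- p (S k) * d n k + - q (S k) * d n (S (S k)))%C
            = (- (p (S k) * d n k) - q (S k) * d n (S (S k)))%C); ring.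
Qed.

(** Induction on the threshold with the coefficients generalized: shifting them by one lowers [N],
    and a solution of the shifted recurrence is extended by one initial term. *)
Lemma bounded_solution_of_dominated (f g h : nat -> C) (N : nat) :
  (forall k, f k <> RtoC 0) ->
  (forall k, (N <= k)%nat -> Cmod (f k) <= / 4 * Cmod (g k)
                           /\ Cmod (h k) <= / 4 * Cmod (g k)) ->
  exists a, (exists k, a k <> RtoC 0) /\ satisfies_recurrence f g h a /\ bounded_seq a.
Proof.
  revert f g h; induction N as [|N IH]; intros f g h Hf H.
  - assert (Hg : forall k, g k <> RtoC 0).
    { intros k; apply Cmod_gt_0; destruct (H k ltac:(lia)) as [H1 _].
      assert (0 < Cmod (f k)) by (apply Cmod_gt_0, Hf); lra. }
    assert (Hdiv : forall u : nat -> C, (forall k, Cmod (u k) <= / 4 * Cmod (g k)) ->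
                   forall k, Cmod (u k / g k) <= / 4).
    { intros u Hu k; rewrite Cmod_div by apply Hg.
      assert (Hgk := proj1 (Cmod_gt_0 _) (Hg k)).
      apply Rmult_le_reg_r with (Cmod (g k)); [exact Hgk|].
      unfold Rdiv; rewrite Rmult_assoc, Rinv_l by lra.
      specialize (Hu k); lra. }
    destruct (contraction_fixed_point (fun k => f k / g k)%C (fun k => h k / g k)%C)
      as [a [Ha0 [Hab Ha]]].
    { intros k; apply Hdiv; intros j; apply H; lia. }
    { intros k; apply Hdiv; intros j; apply H; lia. }
    exists a; repeat split; [|apply recurrence_S|exact Hab].
    + exists 0%nat; rewrite Ha0; apply C1_nz.
    + intros k; rewrite (Ha k); field; apply Hg.
  - destruct (IH (fun k => f (S k)) (fun k => g (S k)) (fun k => h (S k)))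
      as [a [[k0 Hk0] [Ha [M HM]]]].
    { intros k; apply Hf. }
    { intros k Hk; apply H; lia. }
    rewrite recurrence_S in Ha.
    (* The value forced by the relation at index 1, solved for its first term. *)
    set (a0 := (- (g 1%nat * a 0%nat + h 1%nat * a 1%nat) / f 1%nat)%C).
    exists (fun k => match k with O => a0 | S j => a j end).
    repeat split.
    + exists (S k0); exact Hk0.
    + apply recurrence_S; intros [|k]; [|apply Ha].
      unfold a0; field; apply Hf.
    + exists (Rmax (Cmod a0) M); intros [|k]; [apply Rmax_l|].
      eapply Rle_trans; [apply HM|apply Rmax_r].
Qed.

Theorem theorem1p8 (f g h : nat -> C)
  (hf : forall k : nat, f k <> RtoC 0)
  (hh : forall k : nat, h k <> RtoC 0)
  (hfg : little_o f g)
  (hhg : little_o h g) :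
  exists a : nat -> C,
    convergent_series_solution f g h a /\
    (forall b : nat -> C, convergent_series_solution f g h b ->
       exists c : C, c <> RtoC 0 /\ forall k : nat, b k = (c * a k)%C) /\
    (forall z : C, complex_pseries_converges a z).
Proof.
  (* With [/ 4] for each of the two outer coefficients, the fixed point map contracts by [/ 2]. *)
  destruct (little_o_eventually f g h (/ 4) hfg hhg) as [N HN]; [lra|].
  destruct (bounded_solution_of_dominated f g h N hf HN) as [a [Hna [Ha Hab]]].
  assert (Hentire : forall z, complex_pseries_converges a z)
    by (intros z; apply bounded_solution_entire with f g h; assumption).
  exists a; split; [|split; [|exact Hentire]].
  - split; [exact Hna|split; [exact Ha|]].
    apply complex_CV_radius_neq_0; exists (RtoC 1); split; [apply C1_nz|apply Hentire].
  - intros b Hb.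
    assert (Hbb := convergent_solution_bounded f g h b hf hfg hhg Hb).
    destruct Hb as [Hnb [Hb _]].
    apply bounded_solutions_proportional with f g h; assumption.
Qed.
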